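(* Let $\Omega$ be the set of vectors $\mathbf{M}=(M_0,M_1,M_2,M_3,M_4)^t$ such that $M_0>0$, $e>0$, $\eta>e^2+\frac{q^2}{e}$, and $\eta\le 3e^2$ if $q=0$, where $$e=\frac{M_0M_2-M_1^2}{M_0^2},\qquad q=\frac{(M_3M_0^2-M_1^3)-3M_1(M_0M_2-M_1^2)}{M_0^3},$$ $$\eta=\frac{-3M_1^4+M_4M_0^3-4M_0^2M_1M_3+6M_0M_1^2M_2}{M_0^4}.$$ Assume that the vector $\mathbf{M}$ lives in $\Omega$. Then the system $$\partial_t\mathbf{M}+\partial_x\mathbf{F}(\mathbf{M})=\overline{\mathbf{A}},\qquad \mathbf{F}(\mathbf{M})=(M_1,M_2,M_3,M_4,\overline{M}_5)^t,$$ with the two-node Gaussian-EQMOM closure $\overline{M}_5=\overline{M}_5(\mathbf{M})$ is hyperbolic.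
   Context: The system is the five-moment model, with $M_i(t,x)=\int_{\mathbb{R}}f(t,x,v)v^i\,\mathrm{d}v$, of the kinetic equation $\partial_tf+v\,\partial_xf+\partial_v(\mathcal{A}f)=0$ ($t>0$, $x,v\in\mathbb{R}$), where the acceleration $\mathcal{A}$ is a real-valued function of $v$. The source term is $\overline{\mathbf{A}}=(0,\overline{\mathcal{A}}_1,\dots,\overline{\mathcal{A}}_4)^t$ with $\overline{\mathcal{A}}_i=\int_{\mathbb{R}}i\,\mathcal{A}(v)f(t,x,v)v^{i-1}\,\mathrm{d}v$, closed as a function of $\mathbf{M}$ by the reconstruction below; it contains no derivatives of $\mathbf{M}$. Two-node Gaussian-EQMOM (Gaussian extended quadrature method of moments) closure: for $\mathbf{M}\in\Omega$, the function $$f^{G}(v)=\sum_{\alpha=1}^2\frac{\rho_\alpha}{\sigma\sqrt{2\pi}}\exp\left(-\frac{(v-v_\alpha)^2}{2\sigma^2}\right)$$ has parameters $\rho_1,\rho_2>0$, $v_1,v_2\in\mathbb{R}$, $\sigma>0$ determined from $\mathbf{M}$ by requiring $\int_{\mathbb{R}}f^G(v)v^i\,\mathrm{d}v=M_i$ for $i=0,\dots,4$ (setting $\rho_1=\rho_2$ in the case $v_1=v_2$). One then sets $$\overline{M}_5(\mathbf{M})=\int_{\mathbb{R}}f^G(v)v^5\,\mathrm{d}v=\sum_{\alpha=1}^2\rho_\alpha\left(v_\alpha^5+10\sigma^2v_\alpha^3+15\sigma^4v_\alpha\right).$$ Hyperbolic means that the Jacobian matrix of the flux $\mathbf{F}$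 with respect to $\mathbf{M}$ is diagonalizable with real eigenvalues.
   Formalization: At states with v_1 = v_2 (q = 0, η = 3e²), where the closure M̄_5 is discontinuous along Ω and the flux has no Jacobian, the Jacobian is taken as the limit of Jacobians at states with distinct nodes whose parameters (ρ, v, σ) tend to those of M. *)

(* Defs.v *)
From HB Require Import structures.
From mathcomp Require Import all_boot all_order all_algebra.
From mathcomp Require Import all_classical all_reals all_analysis.
Set Implicit Arguments.
Unset Strict Implicit.
Unset Printing Implicit Defensive.
Import Order.TTheory GRing.Theory Num.Theory.
Import numFieldNormedType.Exports.
Local Open Scope classical_set_scope.
Local Open Scope ring_scope.

(* Moment vectors (M_0, ..., M_4) are stored as row vectors, because the      *)
(* topology and the Jacobian of the library are those of 'rV[R]_n.            *)
Definition mom (R : realType) (M : 'rV[R]_5) (i : nat) : R := M 0 (inord i).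

Section RealizableSet.
Variables (R : realType) (M : 'rV[R]_5).
Local Notation M0 := (mom M 0).
Local Notation M1 := (mom M 1).
Local Notation M2 := (mom M 2).
Local Notation M3 := (mom M 3).
Local Notation M4 := (mom M 4).

Definition energy : R := (M0 * M2 - M1 ^+ 2) / M0 ^+ 2.

Definition heat_flux : R :=
  ((M3 * M0 ^+ 2 - M1 ^+ 3) - 3 * M1 * (M0 * M2 - M1 ^+ 2)) / M0 ^+ 3.

Definition eta4 : R :=
  (- 3 * M1 ^+ 4 + M4 * M0 ^+ 3 - 4 * M0 ^+ 2 * M1 * M3
   + 6 * M0 * M1 ^+ 2 * M2) / M0 ^+ 4.

End RealizableSet.

Definition Omega (R : realType) : set 'rV[R]_5 :=
  [set M | [/\ 0 < mom M 0,
               0 < energy M,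
               energy M ^+ 2 + heat_flux M ^+ 2 / energy M < eta4 M
             & heat_flux M = 0 -> eta4 M <= 3 * energy M ^+ 2]].

(* The parameters p of a two-node Gaussian mixture are the triples            *)
(* ((rho_1, rho_2), (v_1, v_2), sigma).                                       *)
Section Closure.
Variable R : realType.
Local Notation mu := (@lebesgue_measure R).
Implicit Types (p : 'rV[R]_2 * 'rV[R]_2 * R) (M : 'rV[R]_5).

Definition weight p (a : 'I_2) : R := p.1.1 0 a.
Definition node p (a : 'I_2) : R := p.1.2 0 a.
Definition width p : R := p.2.

(* For s != 0, normal_pdf m s x unfolds to                                    *)
(*   (Num.sqrt (s ^+ 2 * pi *+ 2))^-1 * expR (- (x - m) ^+ 2 / (s ^+ 2 *+ 2)) *)
Definition fG p (v : R) : R :=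
  \sum_(a < 2) weight p a * normal_pdf (node p a) (width p) v.

Definition fG_moment p (i : nat) : R :=
  (\int[mu]_(v in setT) (fG p v * v ^+ i))%R.

Definition admissible p : Prop :=
  (forall a, 0 < weight p a) /\ 0 < width p.

Definition distinct_nodes p : Prop := node p 0 != node p 1.

Definition is_reconstruction M p : Prop :=
  [/\ admissible p,
      forall i : 'I_5, fG_moment p i = M 0 i
    & node p 0 = node p 1 -> weight p 0 = weight p 1].

(* On Omega the reconstruction is unique up to exchanging the two nodes, and  *)
(* fG does not depend on this exchange; [get] picks one representative.       *)
Definition reconstruction M : 'rV[R]_2 * 'rV[R]_2 * R :=
  get [set p | is_reconstruction M p].

Definition Mbar5 M : R := fG_moment (reconstruction M) 5.

Definition eqmom_flux M : 'rV[R]_5 :=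
  \row_(i < 5) (if (i < 4)%N then mom M i.+1 else Mbar5 M).

Definition eqmom_source (A : R -> R) M : 'rV[R]_5 :=
  \row_(i < 5)
    (\int[mu]_(v in setT) (i%:R * A v * fG (reconstruction M) v * v ^+ i.-1))%R.

End Closure.

(* The system  d_t M + d_x (flux M) = source M.                               *)
Record balance_law (R : realType) (n : nat) := BalanceLaw {
  flux : 'rV[R]_n -> 'rV[R]_n;
  source : 'rV[R]_n -> 'rV[R]_n }.

Definition eqmom_system (R : realType) (A : R -> R) : balance_law R 5 :=
  {| flux := @eqmom_flux R; source := eqmom_source A |}.

(* [jacobian f M] acts on row vectors on the right; its transpose has         *)
(* (i, j) entry d f_i / d M_j.                                                *)
Definition jac_mx (R : realType) (n : nat) (f : 'rV[R]_n -> 'rV[R]_n)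
  (M : 'rV[R]_n) : 'M[R]_n := (jacobian f M)^T.

Definition moments_of (R : realType) (p : 'rV[R]_2 * 'rV[R]_2 * R) : 'rV[R]_5 :=
  \row_(i < 5) fG_moment p i.

(* If the nodes are distinct, J is the Jacobian matrix of the flux F at M,    *)
(* whose existence is part of the definition.                                 *)
(* If they coincide (q = 0 and eta = 3 e^2) then M is not interior to Omega,  *)
(* and Mbar5 is not even continuous along Omega at M: for M = (1,0,1,q,3+q')  *)
(* with q' = Num.sqrt q, Mbar5 tends to 1, not 0, as q decreases to 0. There  *)
(* the Jacobian is its extension by continuity in the reconstruction          *)
(* parameters (the limit as the two nodes merge).                             *)
Definition is_flux_jacobian (R : realType) (F : 'rV[R]_5 -> 'rV[R]_5)
    (M : 'rV[R]_5) (J : 'M[R]_5) : Prop :=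
  let p := reconstruction M in
  (distinct_nodes p -> differentiable F M /\ J = jac_mx F M) /\
  (~ distinct_nodes p ->
     jac_mx F (moments_of p') @[p' --> within
       [set p' | admissible p' /\ distinct_nodes p'] (nbhs p)] --> J).

(* Diagonalizability is over the real field R, so that the eigenvalues are    *)
(* real.                                                                      *)
Definition hyperbolic_at (R : realType) (S : balance_law R 5) (M : 'rV[R]_5) :
    Prop :=
  (exists J, is_flux_jacobian (flux S) M J) /\
  (forall J, is_flux_jacobian (flux S) M J -> diagonalizable J).

(* Main.v *)
Require Import Defs.
From HB Require Import structures.
From mathcomp Require Import all_boot all_order all_algebra.
From mathcomp Require Import all_classical all_reals all_analysis.
From mathcomp Require Import measurable_realfun polyrcf.
From mathcomp Require Import ring lra.
Set Implicit Arguments.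
Unset Strict Implicit.
Unset Printing Implicit Defensive.
Import Order.TTheory GRing.Theory Num.Theory.
Import numFieldNormedType.Exports.
Local Open Scope classical_set_scope.
Local Open Scope ring_scope.

(** Let [s] be the squared width, [u] the mean and [v1], [v2] the nodes of the
    reconstructed mixture, and let [D] be differentiation of polynomials. The
    integral of a polynomial [P] against the mixture is the weighted sum of
    the values of [exp (s D^2 / 2) P] at the two nodes.

    The first four rows of the Jacobian shift the moments, so it is a
    companion matrix, and its characteristic polynomial [P], monic of degree 5,
    is the one whose integral against the mixture is stationary for all five
    parameters. Varying the weights, the nodes and [s] says that
    [Q = exp (s D^2 / 2) P] vanishes to second order at [v1] and [v2] and that
    the weighted sum of [Q''] over the nodes is zero. If [v1]
    and [v2] differ, then [Q = (X - u) (X - v1)^2 (X - v2)^2], and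
    [P = exp (- s D^2 / 2) Q] ([quintic]).

    The operator [exp (- s D^2 / 2)] maps [(X - a) R] to [(X - a) S - s D S]
    where [S = exp (- s D^2 / 2) R]. If [S] is monic with [n] simple real
    roots and no other, the signs of the result alternate along these roots
    and two points beyond them, so it has [n + 1] simple real roots
    ([real_rooted_hermite_step]).
    Starting from [1], five such steps give [P] five distinct real roots,
    whether or not [v1 = v2], and a companion matrix whose characteristic
    polynomial has simple roots is diagonalizable
    ([diagonalizable_companion]).

    It remains to justify the derivatives. Put [t = v1 + v2 - 2 u] and
    [w = - (v1 - u) (v2 - u)]. The moments are polynomials in the mass, [u],
    [s], [t], [w] ([mixture_moment]), and the central quantities of a
    mixture satisfy [e = w + s], [q = t w] and
    [eta - 3 e^2 = w t^2 - 2 w^2]. Eliminating [t] leaves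
    [2 w^3 + (eta - 3 e^2) w = q^2], which has a root between [0] and [e] for
    moments in [Omega], so a reconstruction exists ([exists_reconstruction]).
    Subtracting two instances of this cubic shows that [w] is Lipschitz at
    every point with distinct nodes, and then so are the other parameters
    ([lipschitz_spread]). No derivative of the parameters is needed: because
    [P] is stationary, its integral against a nearby mixture is of second
    order in the change of parameters ([quintic_expectation]), and being of
    second order in the change of the moments is differentiability with the
    expected Jacobian ([flux_jacobian]).

    Where the nodes coincide, the Jacobians at nearby distinct nodes are
    companion matrices of polynomials whose coefficients depend continuously on
    the parameters, so they converge ([flux_jacobian_limit]). *)


(** * Polynomials with simple real roots *)

(** If [exp (- s D^2 / 2)] maps [r] to [p], it maps [('X - a%:P) * r] to
    [hermite_step s a p]. *)
Definition hermite_step (R : nzRingType) (s a : R) (p : {poly R}) : {poly R} :=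
  ('X - a%:P) * p - s *: p^`().

(** The value of [exp (- s D^2 / 2)] at the product of the ['X - a%:P], [a] in
    [rs]; for [rs] constantly [0] these are the Hermite polynomials. *)
Definition backward_heat (R : nzRingType) (s : R) (rs : seq R) : {poly R} :=
  foldr (hermite_step s) 1 rs.

Section HermiteStep.
Variable R : rcfType.
Implicit Types (p q : {poly R}) (rs : seq R).

Lemma sign_product_gt x rs : all (> x) rs ->
  0 < (-1) ^+ size rs * \prod_(z <- rs) (x - z).
Proof.
elim: rs => [|z rs IH] /=; first by rewrite big_nil mulr1.
case/andP=> xz /IH h; rewrite big_cons exprS mulrACA mulN1r opprB.
by rewrite mulr_gt0 // subr_gt0.
Qed.

Lemma product_lt_gt0 x rs : all (< x) rs -> 0 < \prod_(z <- rs) (x - z).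
Proof.
elim: rs => [|z rs IH] /=; first by rewrite big_nil.
by case/andP=> xz /IH h; rewrite big_cons mulr_gt0 // subr_gt0.
Qed.

Lemma roots_of_sign_changes p x ys :
  path (fun y z => (z < y) && (p.[y] * p.[z] < 0)) x ys ->
  exists rs, [/\ size rs = size ys, all (root p) rs, all (< x) rs
               & sorted >%R rs].
Proof.
elim: ys x => [|y ys IH] x /=; first by exists [::].
case/andP=> /andP[yx pxy] /IH[rs [szrs rrs lrs srs]].
have [z /andP[yz zx] rz] : exists2 z, y <= z <= x & root p z.
  case: (ltrP 0 p.[x]) => px.
    apply: poly_ivt; first exact: ltW.
    by rewrite (ltW px) andbT -(pmulr_rle0 _ px) ltW //.
  have px' : p.[x] < 0.
    by rewrite lt_neqAle px andbT; apply: contraTneq pxy => ->; rewrite mul0r ltxx.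
  have [||z zy rz] := @poly_ivt R (- p) y x; first exact: ltW.
    rewrite !hornerN oppr_le0 oppr_ge0 px andbT.
    by rewrite -(nmulr_rle0 _ px') ltW //.
  by exists z => //; rewrite rootN in rz.
have /andP[py px] : (p.[y] != 0) && (p.[x] != 0).
  by rewrite -negb_or -mulf_eq0 mulrC lt_eqF.
have {}yz : y < z.
  rewrite lt_neqAle yz andbT; apply: contraNneq py => ->; exact/eqP/rootP.
have {}zx : z < x.
  rewrite lt_neqAle zx andbT; apply: contraNneq px => <-; exact/eqP/rootP.
exists (z :: rs); split=> /=.
- by rewrite szrs.
- by rewrite rz.
- rewrite zx /=; apply/allP => t /(allP lrs) ty.
  exact: lt_trans ty (lt_trans yz zx).
- case: rs lrs srs {szrs rrs} => //= t rs /andP[ty _] ->; rewrite andbT.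
  exact: lt_trans ty yz.
Qed.

Lemma monic_gt0_right p x : p \is monic -> exists2 y, x < y & 0 < p.[y].
Proof.
move=> /monicP lp; have : 0 < lead_coef p by rewrite lp.
case/poly_pinfty_gt_lc=> n hn; exists (Num.max n (x + 1)).
  by rewrite lt_max (ltrDl x) ltr01 orbT.
by apply: lt_le_trans (hn _ _); rewrite ?lp ?ltr01 // le_max lexx.
Qed.

Lemma monic_sign_left p x : p \is monic ->
  exists2 y, y < x & 0 < (-1) ^+ (size p).-1 * p.[y].
Proof.
move=> mp; have szX : size (- 'X : {poly R}) = 2 by rewrite size_polyN size_polyX.
pose q := (-1) ^+ (size p).-1 *: (p \Po - 'X).
have mq : q \is monic.
  rewrite monicE /q lead_coefZ lead_coef_comp ?szX //.
  rewrite (monicP mp) mul1r lead_coefN lead_coefX.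
  by rewrite -exprMn mulN1r opprK expr1n.
have [y xy qy] := monic_gt0_right (- x) mq.
exists (- y); first by rewrite ltrNl.
by move: qy; rewrite /q hornerZ horner_comp hornerN hornerX.
Qed.

Lemma monic_hermite_step s a p : p \is monic ->
  hermite_step s a p \is monic /\ size (hermite_step s a p) = (size p).+1.
Proof.
move=> mp; have p0 := monic_neq0 mp.
have sz1 : size (('X - a%:P) * p) = (size p).+1.
  by rewrite size_Mmonic ?polyXsubC_eq0 // size_XsubC.
have lt : (size (- (s *: p^`()))%R < size (('X - a%:P) * p)%R)%N.
  rewrite sz1 size_polyN; apply: leq_ltn_trans (size_scale_leq _ _) _.
  by rewrite ltnS ltnW // lt_size_deriv.
split; last by rewrite size_polyDl.
by rewrite monicE lead_coefDl // lead_coef_Mmonic // lead_coefXsubC.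
Qed.

Lemma hermite_step_root s a rs1 x rs2 :
  (hermite_step s a (\prod_(z <- rs1 ++ x :: rs2) ('X - z%:P))).[x] =
    - s * (\prod_(z <- rs1) (x - z) * \prod_(z <- rs2) (x - z)).
Proof.
rewrite (perm_big (x :: (rs1 ++ rs2))) /=; last first.
  by rewrite -cat1s perm_catCA.
rewrite big_cons /hermite_step derivM derivXsubC !hornerE subrr.
rewrite horner_prod big_cat /=.
have ev rs : \prod_(z <- rs) ('X - z%:P).[x] = \prod_(z <- rs) (x - z).
  by apply: eq_bigr => z _; rewrite hornerXsubC.
by rewrite !ev; ring.
Qed.

Lemma sorted_gt_cat rs1 x rs2 : sorted >%R (rs1 ++ x :: rs2) ->
  all (> x) rs1 /\ all (< x) rs2.
Proof.
rewrite sorted_pairwise => [|y z t zy yt]; last exact: lt_trans yt zy.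
by rewrite pairwise_cat allrel_consr /= => /and3P[/andP[-> _] _ /andP[-> _]].
Qed.

(** At a root of the product only [- s p'] remains of [hermite_step], and the
    derivative has one negative factor for each larger root. *)
Lemma sign_hermite_step s a rs1 x rs2 :
  0 < s -> sorted >%R (rs1 ++ x :: rs2) ->
  0 < (-1) ^+ (size rs1).+1 *
      (hermite_step s a (\prod_(z <- rs1 ++ x :: rs2) ('X - z%:P))).[x].
Proof.
move=> s0 /sorted_gt_cat[/sign_product_gt h1 /product_lt_gt0 h2].
rewrite hermite_step_root exprS; set A := _ ^+ _ in h1 *.
set C := \prod_(z <- rs2) _.
set B := \prod_(z <- rs1) _ in h1 *.
have -> : -1 * A * (- s * (B * C)) = s * (A * B) * C by ring.
by rewrite mulr_gt0 // mulr_gt0.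
Qed.

Lemma opposite_signs n (x y : R) :
  0 < (-1) ^+ n * x -> 0 < (-1) ^+ n.+1 * y -> x * y < 0.
Proof. by rewrite exprS -signr_odd; case: (odd n) => /=; nra. Qed.

(** The signs alternate along the roots of the product, framed by a point far
    to the right and one far to the left: this gives one more sign change than
    there were roots, which is all that the degree allows. *)
Lemma real_rooted_hermite_step s a rs : 0 < s -> sorted >%R rs ->
  exists rs', sorted >%R rs' /\
   hermite_step s a (\prod_(z <- rs) ('X - z%:P)) =
   \prod_(z <- rs') ('X - z%:P).
Proof.
move=> s0 srs; set p := \prod_(z <- rs) _; set q := hermite_step s a p.
have [mq szq] : q \is monic /\ size q = (size rs).+2.
  have [|-> ->] := @monic_hermite_step s a p; first exact: monic_prod_XsubC.
  by rewrite size_prod_XsubC.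
have [x0 x0gt qx0] := monic_gt0_right (head 0 rs) mq.
have [y0 y0lt qy0] := monic_sign_left (Num.min x0 (last 0 rs)) mq.
rewrite szq /= in qy0.
have := @roots_of_sign_changes q x0 (rcons rs y0).
case.
  have main rs1 x rs2 : rs = rs1 ++ x :: rs2 ->
      path (fun y z => (z < y) && (q.[y] * q.[z] < 0)) x (rcons rs2 y0).
    elim: rs2 rs1 x => [|y rs2 IH] rs1 x ers /=.
      rewrite andbT; apply/andP; split.
        by apply: lt_le_trans y0lt _; rewrite ers last_cat /= ge_min lexx orbT.
      have := @sign_hermite_step s a rs1 x [::] s0; rewrite -ers => /(_ srs) h.
      apply: opposite_signs h _; rewrite ers size_cat /= addn1 in qy0.
      exact: qy0.
    rewrite (IH (rcons rs1 x)) ?cat_rcons // andbT.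
    have hx := @sign_hermite_step s a rs1 x (y :: rs2) s0.
    have hy := @sign_hermite_step s a (rcons rs1 x) y rs2 s0.
    rewrite -ers in hx; rewrite cat_rcons -ers size_rcons in hy.
    apply/andP; split; last exact: opposite_signs (hx srs) (hy srs).
    by have := srs; rewrite ers => /sorted_gt_cat[_ /andP[]].
  case ers : {1}rs => [|x rs2] /=.
    rewrite andbT; apply/andP; split.
      by apply: lt_le_trans y0lt _; rewrite ge_min lexx.
    apply: (@opposite_signs 0); first by rewrite mul1r.
    by move: qy0; rewrite ers.
  rewrite (main [::]) // andbT; apply/andP; split.
    by move: x0gt; rewrite ers.
  apply: (@opposite_signs 0); first by rewrite mul1r.
  by have := @sign_hermite_step s a [::] x rs2 s0; rewrite -ers; apply.
move=> rs' [sz rrs' _ srs']; exists rs'; split=> //.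
rewrite [LHS](@all_roots_prod_XsubC _ q rs') //.
- by rewrite (monicP mq) scale1r.
- by rewrite szq sz size_rcons.
- rewrite uniq_rootsE; apply: sorted_uniq srs' => [y z t zy yt|z].
    exact: lt_trans yt zy.
  by rewrite /= ltxx.
Qed.

Lemma real_rooted_backward_heat s rs : 0 < s ->
  exists rs', [/\ size rs' = size rs, sorted >%R rs'
    & backward_heat s rs = \prod_(z <- rs') ('X - z%:P)].
Proof.
move=> s0; elim: rs => [|a rs [rs1 [sz srs1 ers1]]].
  by exists [::]; rewrite big_nil.
have [rs2 [srs2 ers2]] := real_rooted_hermite_step a s0 srs1.
exists rs2; rewrite /= ers1; split=> //.
have := monic_hermite_step s a (monic_prod_XsubC rs1 xpredT id).
by rewrite ers2 !size_prod_XsubC => -[_ [->]]; rewrite sz.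
Qed.
End HermiteStep.

Definition companion (R : nzRingType) n (q : {poly R}) : 'M[R]_n :=
  \matrix_(i, j) if i == n.-1 :> nat then - q`_j else (i.+1 == j :> nat)%:R.

Lemma diagonalizable_companion (F : fieldType) n (q : {poly F}) (rs : seq F) :
  size rs = n.+1 -> uniq rs -> q = \prod_(z <- rs) ('X - z%:P) ->
  diagonalizable (companion n.+1 q).
Proof.
move=> szrs urs eq; have mq : q \is monic by rewrite eq; exact: monic_prod_XsubC.
have szq : (size q).-1 = n.+1 by rewrite eq size_prod_XsubC szrs.
have charE : char_poly (companion n.+1 q) = q.
  by have := companionmxK mq; rewrite /companionmx szq.
by apply/diagonalizableP; exists rs => //; rewrite -eq -{2}charE mxminpoly_dvd_char.
Qed.

(** * Moments of a normal density *)

Section GaussianMoments.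
Variable R : realType.
Local Notation mu := (@lebesgue_measure R).

(** The fundamental theorem of calculus on [[- n, n]], with dominated
    convergence for the integrals. *)
Lemma Rintegral_derivative_eq0 (F f : R -> R) :
  continuous f -> (forall x, is_derive x (1 : R) F (f x)) ->
  mu.-integrable setT (EFin \o f) ->
  F n%:R @[n --> \oo] --> (0 : R) -> F (- n%:R) @[n --> \oo] --> (0 : R) ->
  \int[mu]_x f x = 0.
Proof.
move=> cf dF intf Fy FNy.
pose I n := `[(- (n.+1)%:R : R), n.+1%:R].
have dc : (\int[mu]_(x in setT) ((f \_ [set` I n]) x)%:E)%E @[n --> \oo]
    --> (\int[mu]_x (f x)%:E)%E.
  have mf : measurable_fun setT f by exact: continuous_measurable_fun.
  have [] := @dominated_convergence _ _ R mu setT measurableT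
    (fun n x => ((f \_ [set` I n]) x)%:E) (EFin \o f) (abse \o (EFin \o f)).
  - move=> n; apply/measurable_EFinP; apply/(measurable_restrictT f) => //.
    exact: measurable_funTS.
  - by apply/measurable_EFinP.
  - apply: aeW => x _; apply: cvg_near_cst; near=> n.
    rewrite patchE; case: ifPn => //; apply: contraNeq => _.
    rewrite mem_set //= in_itv /= -ler_norml.
    apply: le_trans (ltW (truncnS_gt _)) _; rewrite ler_nat ltnS.
    by near: n; exact: nbhs_infty_ge.
  - exact: (integrable_abse intf).
  - apply: aeW => x n _; rewrite /= patchE; case: ifP => // _.
    by rewrite /= normr0 lee_fin.
  by [].
have e n : (\int[mu]_(x in setT) ((f \_ [set` I n]) x)%:E)%E
    = (F n.+1%:R - F (- n.+1%:R))%:E.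
  rewrite -[RHS](@continuous_FTC2 R f F) //.
  - rewrite [RHS]integral_mkcond; apply: eq_integral => x _.
    by rewrite !patchE; case: ifP.
  - by rewrite gtrN // ltr0n.
  - exact: continuous_subspaceT.
  - have cF : continuous F.
      move=> x; apply: differentiable_continuous; apply/derivable1_diffP.
      exact: ex_derive.
    split; first by move=> x _; exact: ex_derive.
      by apply: cvg_at_right_filter; exact: cF.
    by apply: cvg_at_left_filter; exact: cF.
  - by move=> x _; rewrite derive1E derive_val.
have lim0 : (F n.+1%:R - F (- n.+1%:R))%:E @[n --> \oo] --> (0 : R)%:E.
  apply: cvg_EFin; first exact: nearW.
  rewrite -[X in _ --> X](subr0 0); apply: cvgB.
    by rewrite (cvg_shiftS (fun n => F n%:R)).
  by rewrite (cvg_shiftS (fun n => F (- n%:R))).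
rewrite /Rintegral.
have -> : (\int[mu]_x (f x)%:E)%E = (0:R)%:E; last by [].
rewrite (funext e) in dc.
exact: (cvg_unique _ dc lim0).
Unshelve. all: by end_near. Qed.

Lemma normal_pdf_peak_fun (m s x : R) : 0 < s ->
  normal_pdf m s x = normal_peak s * normal_fun m s x.
Proof. by move=> s0; rewrite normal_pdfE ?gt_eqF. Qed.

(** A power of [x] is absorbed by doubling the width. This gives at once the
    integrability of all monomials and the decay at infinity. *)
Lemma normal_pdf_poly_bound (m s : R) i : 0 < s ->
  exists C, forall x, `|x ^+ i * normal_pdf m s x| <= C * normal_pdf m (2 * s) x.
Proof.
move=> s0; have s2 : 0 < 2 * s by rewrite mulr_gt0.
pose c := 3 / (8 * s ^+ 2); have c0 : 0 < c by rewrite divr_gt0 ?mulr_gt0 ?exprn_gt0.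
pose k : R := i.+1%:R; have k0 : 0 < k by rewrite ltr0n.
pose K := `|m| + 1 + k / c.
have K0 : 0 < K.
  have := divr_gt0 k0 c0; have := normr_ge0 m; rewrite /K; lra.
(* [|x| <= K * expR (c z^2 / k)] with [z = x - m], and its [i]-th power leaves
   room in the exponent [c z^2], by which the two densities differ. *)
exists (K ^+ i * normal_peak s / normal_peak (2 * s)) => x.
rewrite normrM normrX (ger0_norm (normal_pdf_ge0 _ _ _)).
rewrite !normal_pdf_peak_fun //.
have p0 : 0 < normal_peak (2 * s) by rewrite normal_peak_gt0 ?gt_eqF.
have -> : K ^+ i * normal_peak s / normal_peak (2 * s) *
    (normal_peak (2 * s) * normal_fun m (2 * s) x) =
    normal_peak s * (K ^+ i * normal_fun m (2 * s) x).
  by field; rewrite gt_eqF.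
rewrite mulrCA ler_wpM2l ?normal_peak_ge0 //.
rewrite /normal_fun.
have hx : `|x| <= K * expR (c * (x - m) ^+ 2 / k).
  apply: le_trans (_ : K * (1 + c * (x - m) ^+ 2 / k) <= _); last first.
    by rewrite ler_wpM2l ?(ltW K0) // expR_ge1Dx.
  have {1}-> : x = m + (x - m) by ring.
  apply: le_trans (ler_normD _ _) _; set z := x - m.
  have hz : `|z| <= 1 + z ^+ 2 by rewrite ler_norml; apply/andP; split; nra.
  apply: le_trans (_ : `|m| + (1 + z ^+ 2) <= _); first by rewrite lerD2l.
  have -> : K * (1 + c * z ^+ 2 / k) =
      `|m| + 1 + z ^+ 2 + (k / c + (`|m| + 1) * (c * z ^+ 2 / k)).
    by rewrite /K; field; rewrite !gt_eqF.
  have h1 : 0 <= k / c by rewrite divr_ge0 ?ltW.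
  have h2 : 0 <= c * z ^+ 2 / k.
    by apply: divr_ge0; [apply: mulr_ge0|]; rewrite ?sqr_ge0 // ltW.
  by rewrite addrA lerDl addr_ge0 // mulr_ge0 // addr_ge0.
apply: le_trans (_ : (K * expR (c * (x - m) ^+ 2 / k)) ^+ i *
    expR (- (x - m) ^+ 2 / (s ^+ 2 *+ 2)) <= _).
  rewrite ler_wpM2r ?expR_ge0 // lerXn2r // nnegrE.
  by rewrite mulr_ge0 ?expR_ge0 ?(ltW K0).
rewrite exprMn -[leLHS]mulrA ler_wpM2l ?exprn_ge0 ?(ltW K0) //.
rewrite -expRM_natr -expRD ler_expR.
have -> : - (x - m) ^+ 2 / ((2 * s) ^+ 2 *+ 2) =
    c * (x - m) ^+ 2 + - (x - m) ^+ 2 / (s ^+ 2 *+ 2).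
  by rewrite /c; field; rewrite gt_eqF.
rewrite lerD2r -[leLHS]mulrA ler_piMr //.
  by rewrite mulr_ge0 ?sqr_ge0 ?(ltW c0).
by rewrite mulrC ler_pdivrMr // mul1r ler_nat leqnSn.
Qed.

Lemma integrable_monomial_normal (m s : R) i : 0 < s ->
  mu.-integrable setT (EFin \o (fun x => x ^+ i * normal_pdf m s x)).
Proof.
move=> s0; have [C hC] := normal_pdf_poly_bound m i s0.
apply: (@le_integrable _ _ _ mu setT measurableT _
  (fun x => C%:E * (normal_pdf m (2 * s) x)%:E)%E).
- apply/measurable_EFinP; apply: measurable_funM.
    exact: exprn_measurable.
  exact: measurable_normal_pdf.
- move=> x _; rewrite /= lee_fin; apply: le_trans (hC x) _.
  by rewrite ler_norm.
- by apply: integrableZl => //; exact: integrable_normal_pdf.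
Qed.

(** Each derivative is a combination of monomials against the same density, so
    that its vanishing integral is a relation between moments. *)
Lemma is_derive_monomial_normal (m s x : R) i : 0 < s ->
  is_derive x (1 : R) (fun x => x ^+ i * normal_pdf m s x)
   (i%:R * x ^+ i.-1 * normal_pdf m s x
     - s ^- 2 * (x ^+ i.+1 * normal_pdf m s x - m * (x ^+ i * normal_pdf m s x))).
Proof.
move=> s0.
pose g : R -> R := (s ^+ 2 *+ 2)^-1 \*: - ((id - cst m) ^+ 2).
have -> : (fun x => x ^+ i * normal_pdf m s x) =
    (id ^+ i) * (normal_peak s \*: (expR \o g)).
  apply/funext => y; rewrite normal_pdf_peak_fun // /g !fctE /normal_fun /=.
  by rewrite /GRing.scale /= [_ / _]mulrC.
rewrite normal_pdf_peak_fun // /normal_fun.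
have dg : is_derive x (1 : R) g (- s ^- 2 * (x - m)).
  apply: is_derive_eq; rewrite /= !fctE subr0 expr1 /GRing.scale /=; field.
  by rewrite gt_eqF.
have de : is_derive x (1 : R) (expR \o g) (expR (g x) * (- s ^- 2 * (x - m))).
  exact: is_derive1_comp.
apply: is_derive_eq.
rewrite /= !fctE [x ^+ i.+1]exprS /GRing.scale /=.
have -> : expR (g x) = expR (- (x - m) ^+ 2 / (s ^+ 2 *+ 2)).
  by rewrite /g !fctE /GRing.scale /= mulrC.
by field; rewrite gt_eqF.
Qed.

Lemma normal_moment_lim (m s : R) i (u : R^nat) : 0 < s ->
   (forall n, `|u n| = n%:R) ->
   u n ^+ i * normal_pdf m s (u n) @[n --> \oo] --> (0 : R).
Proof.
move=> s0 hu; have [C hC] := normal_pdf_poly_bound m i.+1 s0.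
have [D hD] : exists D, forall x, `|x ^+ i.+1 * normal_pdf m s x| <= D.
  exists (`|C| * normal_peak (2 * s)) => x; apply: le_trans (hC x) _.
  apply: le_trans (ler_norm _) _; rewrite normrM ler_wpM2l //.
  by rewrite ger0_norm ?normal_pdf_ge0 // normal_pdf_ub // gt_eqF // mulr_gt0.
apply/cvgr0Pnorm_le => e e0; near=> n.
have n0 : (0 : R) < n%:R by rewrite ltr0n; near: n; exact: nbhs_infty_gt.
have un0 : 0 < `|u n| by rewrite hu.
rewrite -(ler_pM2l un0) -normrM mulrA -exprS hu.
apply: le_trans (hD _) _; rewrite -ler_pdivrMr //.
near: n; exact: nbhs_infty_ger.
Unshelve. all: by end_near. Qed.

Definition normal_moment (m s : R) i := \int[mu]_x (x ^+ i * normal_pdf m s x).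

Lemma normal_moment0 (m s : R) : 0 < s -> normal_moment m s 0 = 1.
Proof.
move=> s0; rewrite /normal_moment /Rintegral.
under eq_integral do rewrite expr0 mul1r.
by rewrite integral_normal_pdf.
Qed.

(** Integration by parts: the integral of the derivative of [x ^+ i] times the
    density is zero. *)
Lemma normal_momentS (m s : R) i : 0 < s ->
  normal_moment m s i.+1 =
    m * normal_moment m s i + i%:R * s ^+ 2 * normal_moment m s i.-1.
Proof.
move=> s0; have s00 : s != 0 by rewrite gt_eqF.
pose F k (x : R) := x ^+ k * normal_pdf m s x.
have cF k : continuous (F k).
  move=> x; apply: cvgM; last exact: continuous_normal_pdf.
  exact: exprn_continuous.
have intF k : mu.-integrable setT (EFin \o F k) by exact: integrable_monomial_normal.
have intZ (c : R) k : mu.-integrable setT (EFin \o (fun x => c * F k x)).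
  rewrite (_ : _ \o _ = (fun x => c%:E * (F k x)%:E)%E); last exact/funext.
  by apply: integrableZl => //; exact: intF.
pose f x := i%:R * F i.-1 x + (- s ^- 2 * F i.+1 x + s ^- 2 * m * F i x).
have intf2 : mu.-integrable setT
    (EFin \o (fun x => - s ^- 2 * F i.+1 x + s ^- 2 * m * F i x)).
  have := integrableD measurableT (intZ (- s ^- 2) i.+1) (intZ (s ^- 2 * m) i).
  by apply: eq_integrable.
have I0 : \int[mu]_x f x = 0.
  apply: (@Rintegral_derivative_eq0 (F i)).
  - move=> x; apply: cvgD; first by apply: cvgM; [exact: cvg_cst|exact: cF].
    by apply: cvgD; apply: cvgM; by [exact: cvg_cst|exact: cF].
  - move=> x; apply: is_derive_eq (is_derive_monomial_normal _ _ _ s0) _.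
    by rewrite /f /F; ring.
  - have := integrableD measurableT (intZ i%:R i.-1) intf2.
    by apply: eq_integrable.
  - by apply: normal_moment_lim => // n; rewrite ger0_norm.
  - by apply: normal_moment_lim => // n; rewrite normrN ger0_norm.
move: I0; rewrite /f RintegralD // RintegralD // !RintegralZl //.
rewrite -![\int[mu]_x F _ x]/(normal_moment m s _) => h.
apply/eqP; rewrite -subr_eq0; apply/eqP.
rewrite -[RHS](mulr0 (- s ^+ 2)) -h; field.
exact: s00.
Qed.

End GaussianMoments.

(** * Mixtures of two Gaussians *)

Section Mixture.
Variable R : realType.
Local Notation mu := (@lebesgue_measure R).
Local Notation params := ('rV[R]_2 * 'rV[R]_2 * R)%type.
Implicit Types (p : params) (M : 'rV[R]_5).

(** [mass], [mean], [width ^+ 2], [skewness] and [spread] are symmetric in the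
    two nodes, unlike the weights and nodes, and determine the moments.
    [skewness] and [spread] are such that [z = node - mean] solves
    [z ^+ 2 = skewness * z + spread] at both nodes. *)
Definition mass p := weight p 0 + weight p 1.
Definition mean p := (weight p 0 * node p 0 + weight p 1 * node p 1) / mass p.
Definition skewness p := node p 0 + node p 1 - 2 * mean p.
Definition spread p := - ((node p 0 - mean p) * (node p 1 - mean p)).

(** The moments about the origin in terms of the central ones [c2], [c3], [c4],
    [c5]. The polynomial form remains valid when the nodes coincide, where
    [t = w = 0]. *)
Definition mixture_moment (m u s t w : R) (i : nat) : R :=
  let c2 := w + s in
  let c3 := t * w in
  let c4 := w * (t ^+ 2 + w) + 6 * w * s + 3 * s ^+ 2 in
  let c5 := w * (t ^+ 3 + 2 * t * w) + 10 * s * t * w in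
  match i with
  | 0 => m
  | 1 => m * u
  | 2 => m * (u ^+ 2 + c2)
  | 3 => m * (u ^+ 3 + 3 * u * c2 + c3)
  | 4 => m * (u ^+ 4 + 6 * u ^+ 2 * c2 + 4 * u * c3 + c4)
  | 5 => m * (u ^+ 5 + 10 * u ^+ 3 * c2 + 10 * u ^+ 2 * c3 + 5 * u * c4 + c5)
  | _ => 0
  end.

Lemma fG_momentE p i : 0 < width p ->
  fG_moment p i = weight p 0 * normal_moment (node p 0) (width p) i +
                  weight p 1 * normal_moment (node p 1) (width p) i.
Proof.
move=> s0; rewrite /fG_moment /fG.
pose g a x := weight p a * (x ^+ i * normal_pdf (node p a) (width p) x).
have ig a : mu.-integrable setT (EFin \o (g a)).
  rewrite (_ : _ \o _ = (fun x => (weight p a)%:E *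
    (x ^+ i * normal_pdf (node p a) (width p) x)%:E)%E); last exact/funext.
  by apply: integrableZl => //; exact: integrable_monomial_normal.
transitivity (\int[mu]_x (g 0 x + g 1 x)).
  apply: eq_Rintegral => x _; rewrite big_ord_recl big_ord1 mulrDl /g.
  have -> : lift ord0 ord0 = 1 :> 'I_2 by exact/val_inj.
  by rewrite -!mulrA ![_ * x ^+ i]mulrC.
by rewrite RintegralD // !RintegralZl //; exact: integrable_monomial_normal.
Qed.

(** The discrete central moments [D_k] satisfy [D_(k+2) = t D_(k+1) + w D_k]
    with [D_0] the mass and [D_1 = 0]; a normal moment of a node is a polynomial
    in its deviation from the mean. *)
Lemma two_node_mixture_moment (a b v1 v2 s : R) i : 0 < a -> 0 < b -> 0 < s ->
  (i < 6)%N ->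
  let u := (a * v1 + b * v2) / (a + b) in
  a * normal_moment v1 s i + b * normal_moment v2 s i =
  mixture_moment (a + b) u (s ^+ 2) (v1 + v2 - 2 * u)
    (- ((v1 - u) * (v2 - u))) i.
Proof.
move=> a0 b0 s0 i6 u.
have D1 : a * (v1 - u) + b * (v2 - u) = 0.
  by rewrite /u; field; rewrite gt_eqF ?addr_gt0.
have [x ex] : exists x, x = v1 - u by exists (v1 - u).
have [y ey] : exists y, y = v2 - u by exists (v2 - u).
have ev1 : v1 = u + x by rewrite ex; ring.
have ev2 : v2 = u + y by rewrite ey; ring.
rewrite -ex -ey in D1 *.
move: (u) ev1 ev2 => {ex ey} {}u -> ->.
have -> : u + x + (u + y) - 2 * u = x + y by ring.
have D2 : a * x ^+ 2 + b * y ^+ 2 = (a + b) * - (x * y).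
  have -> : a * x ^+ 2 + b * y ^+ 2 =
    (x + y) * (a * x + b * y) + (a + b) * - (x * y) by ring.
  by rewrite D1 mulr0 add0r.
have rec k : a * x ^+ k.+2 + b * y ^+ k.+2 =
    (x + y) * (a * x ^+ k.+1 + b * y ^+ k.+1)
    + - (x * y) * (a * x ^+ k + b * y ^+ k).
  by rewrite !exprS; ring.
have D3 := rec 1; rewrite !expr1 D1 D2 in D3.
have D4 := rec 2; rewrite D3 D2 in D4.
have D5 := rec 3; rewrite D4 D3 in D5.
(* The coefficients below are the derivatives of the [i]-th normal moment with
   respect to the node, at [u], divided by factorials. *)
move: i6; do 6?[case: i => [_|i]]; last by rewrite !ltnS ltn0.
all: rewrite ?(normal_moment0, normal_momentS) //=; set r := s ^+ 2.
- by ring.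
- transitivity (u * (a + b) + (a * x + b * y)); first by ring.
  by rewrite D1; ring.
- transitivity ((u ^+ 2 + r) * (a + b) + 2 * u * (a * x + b * y)
     + (a * x ^+ 2 + b * y ^+ 2)); first by ring.
  by rewrite D1 D2; ring.
- transitivity ((u ^+ 3 + 3 * u * r) * (a + b)
     + (3 * u ^+ 2 + 3 * r) * (a * x + b * y)
     + 3 * u * (a * x ^+ 2 + b * y ^+ 2) + (a * x ^+ 3 + b * y ^+ 3)); first by ring.
  by rewrite D1 D2 D3; ring.
- transitivity ((u ^+ 4 + 6 * u ^+ 2 * r + 3 * r ^+ 2) * (a + b)
     + (4 * u ^+ 3 + 12 * u * r) * (a * x + b * y)
     + (6 * u ^+ 2 + 6 * r) * (a * x ^+ 2 + b * y ^+ 2)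
     + 4 * u * (a * x ^+ 3 + b * y ^+ 3)
     + (a * x ^+ 4 + b * y ^+ 4)); first by ring.
  by rewrite D1 D2 D3 D4; ring.
- transitivity ((u ^+ 5 + 10 * u ^+ 3 * r + 15 * u * r ^+ 2) * (a + b)
     + (5 * u ^+ 4 + 30 * u ^+ 2 * r + 15 * r ^+ 2) * (a * x + b * y)
     + (10 * u ^+ 3 + 30 * u * r) * (a * x ^+ 2 + b * y ^+ 2)
     + (10 * u ^+ 2 + 10 * r) * (a * x ^+ 3 + b * y ^+ 3)
     + 5 * u * (a * x ^+ 4 + b * y ^+ 4)
     + (a * x ^+ 5 + b * y ^+ 5)); first by ring.
  by rewrite D1 D2 D3 D4 D5; ring.
Qed.

Lemma fG_moment_mixture p i : admissible p -> (i < 6)%N ->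
  fG_moment p i =
  mixture_moment (mass p) (mean p) (width p ^+ 2) (skewness p) (spread p) i.
Proof.
move=> [w0 s0] i6; rewrite fG_momentE //.
exact: two_node_mixture_moment.
Qed.

Lemma mass_gt0 p : admissible p -> 0 < mass p.
Proof. by move=> [w0 _]; rewrite addr_gt0. Qed.

Lemma spreadE p : admissible p ->
  spread p = weight p 0 * weight p 1 * (node p 0 - node p 1) ^+ 2 / mass p ^+ 2.
Proof.
move=> ap; have := mass_gt0 ap; rewrite /spread /mean /mass => m0.
by field; rewrite gt_eqF.
Qed.

Lemma spread_gt0 p : admissible p -> distinct_nodes p -> 0 < spread p.
Proof.
move=> ap dp; rewrite spreadE // divr_gt0 ?exprn_gt0 ?mass_gt0 //.
have [w0 _] := ap; apply: mulr_gt0; first exact: mulr_gt0.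
by rewrite exprn_even_gt0 //= subr_eq0.
Qed.

Lemma spread_ge0 p : admissible p -> 0 <= spread p.
Proof.
move=> ap; rewrite spreadE // divr_ge0 ?sqr_ge0 //.
have [w0 _] := ap; apply: mulr_ge0; last exact: sqr_ge0.
by rewrite ltW // mulr_gt0.
Qed.

Lemma mixture_energy M m u s t w : m != 0 ->
  (forall k, (k < 5)%N -> mom M k = mixture_moment m u s t w k) ->
  [/\ energy M = w + s, heat_flux M = t * w
   & eta4 M = w * (t ^+ 2 + w) + 6 * w * s + 3 * s ^+ 2].
Proof.
move=> m0 h; rewrite /energy /heat_flux /eta4 !h //=.
by split; field.
Qed.

Lemma moments_mom p k : admissible p -> (k < 5)%N ->
  mom (moments_of p) k =
  mixture_moment (mass p) (mean p) (width p ^+ 2) (skewness p) (spread p) k.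
Proof.
move=> ap k5; rewrite /mom mxE inordK // fG_moment_mixture //.
exact: ltn_trans k5 _.
Qed.

Lemma reconstruction_momentsE M p : is_reconstruction M p -> moments_of p = M.
Proof.
by case=> _ h _; apply/rowP => i; rewrite mxE h.
Qed.

(** The converse of [exists_reconstruction] at distinct nodes. It makes [Mbar5]
    available at the moments of nearby mixtures. *)
Lemma Omega_moments p : admissible p -> distinct_nodes p ->
  Omega (moments_of p).
Proof.
move=> ap dp; have m0 := mass_gt0 ap; have w0 := spread_gt0 ap dp.
have [e q n] := mixture_energy (lt0r_neq0 m0) (fun k => @moments_mom p k ap).
have s0 : 0 < width p ^+ 2 by case: ap => _ s0; rewrite exprn_gt0.
have e0 : 0 < energy (moments_of p) by rewrite e addr_gt0.
split=> //.
- by rewrite moments_mom.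
- rewrite -subr_gt0 n q e.
  set w := spread p in w0 *; set s := width p ^+ 2 in s0 *; set t := skewness p.
  have -> : w * (t ^+ 2 + w) + 6 * w * s + 3 * s ^+ 2 -
     ((w + s) ^+ 2 + (t * w) ^+ 2 / (w + s)) =
     s * (w * t ^+ 2 / (w + s) + 4 * w + 2 * s).
    by field; rewrite gt_eqF // addr_gt0.
  have h : 0 <= w * t ^+ 2 / (w + s).
    apply: divr_ge0; last by rewrite ltW // addr_gt0.
    by apply: mulr_ge0; [exact: ltW|exact: sqr_ge0].
  by apply: mulr_gt0 => //; lra.
- rewrite n q e => /eqP; rewrite mulf_eq0 (gt_eqF w0) orbF => /eqP ->.
  have := sqr_ge0 (spread p); nra.
Qed.

(** [w] is a root of [2 w^3 + (n - 3 e^2) w = q^2]: the two sides compare in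
    opposite ways at [0] and at [e]. For [q = 0] the root [0] has to be
    discarded unless [n = 3 e^2], which leaves a quadratic equation. *)
Lemma exists_spread (e q n : R) : 0 < e -> e ^+ 2 + q ^+ 2 / e < n ->
  (q = 0 -> n <= 3 * e ^+ 2) ->
  exists w t, [/\ 0 <= w < e, t * w = q, n - 3 * e ^+ 2 = w * t ^+ 2 - 2 * w ^+ 2
    & w = 0 -> t = 0].
Proof.
move=> e0 hn; have [-> /(_ erefl) n3 |q0 _] := eqVneq q 0.
  have w2 : 0 <= (3 * e ^+ 2 - n) / 2 by rewrite divr_ge0 // subr_ge0.
  exists (Num.sqrt ((3 * e ^+ 2 - n) / 2)), 0; split=> //.
  - rewrite sqrtr_ge0 /= -(ltr_pXn2r (n := 2)) ?nnegrE ?sqrtr_ge0 ?(ltW e0) //.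
    rewrite sqr_sqrtr //.
    have : 0 <= q ^+ 2 / e by rewrite divr_ge0 ?sqr_ge0 ?(ltW e0).
    lra.
  - by rewrite mul0r.
  - by rewrite sqr_sqrtr //; field.
pose p : {poly R} := 2%:P * 'X^3 + (n - 3 * e ^+ 2)%:P * 'X - (q ^+ 2)%:P.
have pE x : p.[x] = 2 * x ^+ 3 + (n - 3 * e ^+ 2) * x - q ^+ 2.
  by rewrite /p !hornerE.
have q2 : 0 < q ^+ 2 by rewrite exprn_even_gt0.
have pe : 0 < p.[e].
  have -> : p.[e] = e * (n - (e ^+ 2 + q ^+ 2 / e)).
    by rewrite pE; field; rewrite gt_eqF.
  by rewrite mulr_gt0 // subr_gt0.
have [w /andP[w0 we] /rootP] : exists2 w, 0 <= w <= e & root p w.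
  apply: poly_ivt; first exact: ltW.
  by rewrite (ltW pe) andbT pE expr0n mulr0 mulr0 !add0r oppr_le0 ltW.
rewrite pE => pw.
have wn0 : w != 0 by apply: contraNneq q0 => w00; move: pw; rewrite w00; nra.
exists w, (q / w); split.
- rewrite w0 lt_neqAle we andbT; apply: contraTneq pe => <-.
  by rewrite pE pw ltxx.
- by rewrite mulfVK.
- have -> : n - 3 * e ^+ 2 = (q ^+ 2 - 2 * w ^+ 3) / w.
    have -> : q ^+ 2 = 2 * w ^+ 3 + (n - 3 * e ^+ 2) * w by lra.
    by field.
  by field.
- by move=> w00; rewrite w00 eqxx in wn0.
Qed.

Definition pair_row (x y : R) : 'rV[R]_2 := \row_a (if a == 0 then x else y).

(** The nodes are [u] plus the roots of [z ^+ 2 = t z + w], and the weights are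
    those that make [u] the mean. For [w = 0] both nodes are [u]. *)
Lemma exists_params (m u s t w : R) : 0 < m -> 0 < s -> 0 <= w ->
  (w = 0 -> t = 0) ->
  exists p, [/\ admissible p, node p 0 = node p 1 -> weight p 0 = weight p 1
   & [/\ mass p = m, mean p = u, width p ^+ 2 = s, skewness p = t & spread p = w]].
Proof.
move=> m0 s0 w0 tw; pose d := Num.sqrt (t ^+ 2 + 4 * w).
have d2 : d ^+ 2 = t ^+ 2 + 4 * w.
  by rewrite sqr_sqrtr // addr_ge0 ?sqr_ge0 ?mulr_ge0.
have s2 : Num.sqrt s ^+ 2 = s by rewrite sqr_sqrtr // ltW.
have ss : 0 < Num.sqrt s by rewrite sqrtr_gt0.
have [w00|wn0] := eqVneq w 0.
  exists ((pair_row (m / 2) (m / 2), pair_row u u), Num.sqrt s).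
  rewrite /admissible /spread /skewness /mean /mass /width /node /weight /= !mxE /=.
  split=> //.
    by split=> // a; rewrite mxE; case: ifP => _; rewrite divr_gt0.
  by rewrite w00 (tw w00); split=> //; field; rewrite // gt_eqF ?addr_gt0.
have {}w0 : 0 < w by rewrite lt_neqAle eq_sym wn0.
have d0 : 0 < d by rewrite sqrtr_gt0 ltr_wpDl ?sqr_ge0 ?mulr_gt0.
have /andP[td1 td2] : (t < d) && (- d < t).
  rewrite andbC -ltr_norml -(ltr_pXn2r (n := 2)) ?nnegrE ?(ltW d0) //.
  by rewrite real_normK ?num_real // d2 ltrDl mulr_gt0.
exists ((pair_row (m * (t + d) / (2 * d)) (m * (d - t) / (2 * d)),
  pair_row (u + (t - d) / 2) (u + (t + d) / 2)), Num.sqrt s).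
rewrite /admissible /spread /skewness /mean /mass /width /node /weight /= !mxE /=.
have ew : w = (d ^+ 2 - t ^+ 2) / 4 by rewrite d2; field.
split=> //.
- split=> // a; rewrite mxE; case: ifP => _; rewrite divr_gt0 ?mulr_gt0 //.
    by rewrite -ltrBlDr sub0r.
  by rewrite subr_gt0.
- by move=> h; exfalso; move: h; lra.
- have dn0 : d != 0 by rewrite gt_eqF.
  (* The denominator that comes from dividing by the mass. *)
  have den0 : m * (t + d) + m * (d - t) != 0.
    by rewrite -mulrDr addrC addrA subrK mulf_neq0 ?gt_eqF // addr_gt0.
  by rewrite ew; split=> //; field; rewrite ?dn0 ?den0.
Qed.

Lemma exists_reconstruction M : Omega M -> exists p, is_reconstruction M p.
Proof.
case=> m0 e0 hn hq.
have [w [t [/andP[w0 we] tw nE wt]]] := exists_spread e0 hn hq.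
have se0 : 0 < energy M - w by rewrite subr_gt0.
have [p [ap np [em eu es et ew]]] :=
  exists_params (mom M 1 / mom M 0) m0 se0 w0 wt.
exists p; split=> // i; rewrite fG_moment_mixture ?(ltn_trans (ltn_ord i)) //.
rewrite em eu es et ew.
have -> : M 0 i = mom M i by rewrite /mom inord_val.
have mn0 : mom M 0 != 0 by rewrite gt_eqF.
have c2 : w + (energy M - w) = energy M by ring.
case: i => -[|[|[|[|[|//]]]]] _ /=.
- by [].
- by field.
- by rewrite c2 /energy; field.
- by rewrite c2 tw /energy /heat_flux; field.
- rewrite tw.
  have -> : w * (t ^+ 2 + w) + 6 * w * (energy M - w)
      + 3 * (energy M - w) ^+ 2 = eta4 M.
    have -> : eta4 M = 3 * energy M ^+ 2 + (w * t ^+ 2 - 2 * w ^+ 2).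
      by rewrite -nE; ring.
    by ring.
  by rewrite c2 /energy /heat_flux /eta4; field.
Qed.

Lemma reconstructionP M : Omega M -> is_reconstruction M (reconstruction M).
Proof.
move=> /exists_reconstruction[p hp].
by apply: (getPex (P := [set p | is_reconstruction M p])); exists p.
Qed.

End Mixture.

(** * Lipschitz estimates at a point *)

Section Order.
Variables (R : realType) (V : normedModType R) (x : V).
Implicit Types (f g : V -> R) (j k : nat) (a b : R).

(** Only the exponents [0] (locally bounded), [1] and [2] occur below; products
    add exponents. *)
Definition bigO_pow k f :=
  exists C, \forall y \near x, `|f y| <= C * `|y - x| ^+ k.

(** The value [a] is separate from [f x] because the parameters of a
    reconstruction are compared with those of a given mixture with the same
    moments, and that both agree is a consequence of the estimate. *)
Definition lipschitz_to f a := bigO_pow 1 (fun y => f y - a).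

Lemma bigO_pow_near k f g : (\forall y \near x, f y = g y) ->
  bigO_pow k f -> bigO_pow k g.
Proof.
move=> fg [C hC]; exists C; near=> y.
rewrite -(_ : f y = g y); last by near: y.
by near: y.
Unshelve. all: by end_near. Qed.

Lemma eq_bigO_pow k f g : f =1 g -> bigO_pow k f -> bigO_pow k g.
Proof. by move=> /funext ->. Qed.

Lemma bigO_powD k f g : bigO_pow k f -> bigO_pow k g ->
  bigO_pow k (fun y => f y + g y).
Proof.
move=> [C hC] [D hD]; exists (C + D); near=> y.
rewrite mulrDl; apply: le_trans (ler_normD _ _) _.
by apply: lerD; near: y.
Unshelve. all: by end_near. Qed.

Lemma bigO_powM j k f g : bigO_pow j f -> bigO_pow k g ->
  bigO_pow (j + k) (fun y => f y * g y).
Proof.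
move=> [C hC] [D hD]; exists (C * D); near=> y.
rewrite normrM exprD mulrACA.
by apply: ler_pM => //; near: y.
Unshelve. all: by end_near. Qed.

Lemma bigO_pow_cst a : bigO_pow 0 (fun=> a).
Proof. by exists `|a|; apply: nearW => y; rewrite expr0 mulr1. Qed.

Lemma bigO_pow_le j k f : (j <= k)%N -> bigO_pow k f -> bigO_pow j f.
Proof.
move=> jk [C hC]; exists `|C|; near=> y.
apply: le_trans (_ : `|C| * `|y - x| ^+ k <= _).
  apply: le_trans (_ : C * `|y - x| ^+ k <= _); first by near: y.
  by rewrite ler_wpM2r ?exprn_ge0 // ler_norm.
apply: ler_wpM2l => //; apply: ler_wiXn2l; [exact: normr_ge0| |exact: jk].
by rewrite distrC; near: y; apply: cvgr_dist_le; [exact: cvg_id|exact: ltr01].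
Unshelve. all: by end_near. Qed.

Lemma bigO_powZ k a f : bigO_pow k f -> bigO_pow k (fun y => a * f y).
Proof. by move=> hf; apply: (bigO_powM (bigO_pow_cst a) hf). Qed.

Lemma lipschitz_bounded f a : lipschitz_to f a -> bigO_pow 0 f.
Proof.
move=> hf; apply: (@bigO_pow_near _ (fun y => (f y - a) + a)).
  by apply: nearW => y; rewrite subrK.
by apply: bigO_powD; [exact: bigO_pow_le hf|exact: bigO_pow_cst].
Qed.

Lemma lipschitz_near f g a : (\forall y \near x, f y = g y) ->
  lipschitz_to f a -> lipschitz_to g a.
Proof.
by move=> fg; apply: bigO_pow_near; apply: filterS fg => y ->.
Qed.

Lemma lipschitz_nonexpansive f a : (forall y, `|f y - a| <= `|y - x|) ->
  lipschitz_to f a.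
Proof. by move=> hf; exists 1; apply: nearW => y; rewrite mul1r expr1. Qed.

Lemma lipschitz_cst a : lipschitz_to (fun=> a) a.
Proof. by exists 0; apply: nearW => y; rewrite subrr normr0 mul0r. Qed.

Lemma lipschitzD f g a b : lipschitz_to f a -> lipschitz_to g b ->
  lipschitz_to (fun y => f y + g y) (a + b).
Proof.
move=> hf hg; apply: bigO_pow_near (bigO_powD hf hg).
by apply: nearW => y; ring.
Qed.

Lemma lipschitzM f g a b : lipschitz_to f a -> lipschitz_to g b ->
  lipschitz_to (fun y => f y * g y) (a * b).
Proof.
move=> hf hg.
have := bigO_powD (bigO_powM hf (lipschitz_bounded hg)) (bigO_powZ a hg).
by apply: bigO_pow_near; apply: nearW => y; ring.
Qed.

Lemma lipschitzN f a : lipschitz_to f a -> lipschitz_to (fun y => - f y) (- a).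
Proof.
move=> hf; have := lipschitzM (lipschitz_cst (-1)) hf.
by rewrite mulN1r; apply: lipschitz_near; apply: nearW => y; rewrite mulN1r.
Qed.

Lemma lipschitzB f g a b : lipschitz_to f a -> lipschitz_to g b ->
  lipschitz_to (fun y => f y - g y) (a - b).
Proof. by move=> hf /lipschitzN; exact: lipschitzD. Qed.

Lemma lipschitzX f a k : lipschitz_to f a ->
  lipschitz_to (fun y => f y ^+ k) (a ^+ k).
Proof.
move=> hf; elim: k => [|k IH]; first exact: lipschitz_cst.
rewrite exprS; apply: lipschitz_near (lipschitzM hf IH).
by apply: nearW => y; rewrite exprS.
Qed.

Lemma lipschitz_cvg f a : lipschitz_to f a -> f @ x --> a.
Proof.
move=> [C hC]; apply/cvgrPdist_le => e e0; near=> y.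
rewrite distrC; apply: le_trans (_ : (`|C| + 1) * `|y - x| <= _).
  apply: le_trans (_ : C * `|y - x| ^+ 1 <= _); first by near: y.
  by rewrite expr1 ler_wpM2r // (le_trans (ler_norm _)) // lerDl.
have C0 : 0 < `|C| + 1 by rewrite ltr_wpDl.
rewrite -ler_pdivlMl // distrC; near: y.
by apply: cvgr_dist_le => //; rewrite mulr_gt0 // invr_gt0.
Unshelve. all: by end_near. Qed.

Lemma lipschitz_gt0 f a : lipschitz_to f a -> 0 < a -> \forall y \near x, 0 < f y.
Proof. by move=> /lipschitz_cvg fa a0; exact: (cvgr_gt a fa). Qed.

Lemma lipschitzV f a : 0 < a -> lipschitz_to f a ->
  lipschitz_to (fun y => (f y)^-1) a^-1.
Proof.
move=> a0 hf; have fb : bigO_pow 0 (fun y => (f y)^-1).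
  exists (2 / a); near=> y; have fy : a / 2 < f y.
    near: y; apply: (cvgr_gt a (lipschitz_cvg hf)).
    by rewrite ltr_pdivrMr // ltr_pMr // ltr1n.
  have a2 : 0 < a / 2 by rewrite divr_gt0.
  have f0 : 0 < f y by exact: lt_trans a2 fy.
  rewrite expr0 mulr1 normfV gtr0_norm // -[2 / a]invf_div lef_pV2 ?posrE //.
  exact: ltW.
have := bigO_powZ (- a^-1) (bigO_powM hf fb); apply: bigO_pow_near.
near=> y; have f0 : 0 < f y by near: y; exact: (lipschitz_gt0 hf).
by field; rewrite !gt_eqF.
Unshelve. all: by end_near. Qed.

End Order.

(** A quadratic remainder is a little-o of the increment. *)
Lemma diff_quadratic_remainder (R : realType) (V W : normedModType R)
    (F : V -> W) (x : V) (L : {linear V -> W}) (C : R) :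
  continuous L ->
  (\forall y \near x, `|F y - F x - L (y - x)| <= C * `|y - x| ^+ 2) ->
  differentiable F x /\ 'd F x = L :> (V -> W).
Proof.
move=> cL hF.
have E : F \o shift x = cst (F x) + L +o_ 0 id.
  apply/eqaddoP => e e0; near=> h.
  rewrite !fctE /= opprD addrA -[X in L X](addrK x).
  apply: le_trans (_ : C * `|h + x - x| ^+ 2 <= _).
    near: h; move: hF; rewrite (near_shift 0) subr0; exact.
  rewrite addrK expr2 mulrA ler_wpM2r //.
  apply: le_trans (_ : (`|C| + 1) * `|h| <= _).
    by rewrite ler_wpM2r // (le_trans (ler_norm _)) // lerDl.
  have C0 : 0 < `|C| + 1 by rewrite ltr_wpDl.
  rewrite -ler_pdivlMl //; near: h.
  apply: cvgr0_norm_le; first exact: cvg_id.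
  by rewrite mulr_gt0 // invr_gt0.
have dE := diff_unique cL E; split=> //.
by apply/diff_locallyP; rewrite dE.
Unshelve. all: by end_near. Qed.

Section Jacobian.
Variables (R : realType) (n : nat).

Lemma mulmxr_continuous (B : 'M[R]_n) : continuous (mulmxr B : 'rV[R]_n -> 'rV[R]_n).
Proof.
have -> : (mulmxr B : 'rV[R]_n -> 'rV[R]_n) = fun h => \sum_k h 0 k *: row k B.
  by apply/funext => h; rewrite /= mulmx_sum_row.
apply: continuous_big => [|k _ h]; first exact: add_continuous.
apply: cvgZ; first exact: nbhs_filter.
  exact: coord_continuous.
by apply: cvg_cst; exact: nbhs_filter.
Qed.

Lemma jacobian_quadratic_remainder (F : 'rV[R]_n -> 'rV[R]_n) (x : 'rV[R]_n)
    (B : 'M[R]_n) (C : R) :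
  (\forall y \near x, `|F y - F x - (y - x) *m B| <= C * `|y - x| ^+ 2) ->
  differentiable F x /\ jacobian F x = B.
Proof.
move=> hF; have [dF eF] := diff_quadratic_remainder (@mulmxr_continuous B) hF.
split=> //; rewrite /jacobian; apply/row_matrixP => i.
by rewrite !rowE mul_rV_lin1 eF.
Qed.

End Jacobian.

(** * Jacobian of the flux *)

Lemma coef_hermite_step (R : comNzRingType) (s a : R) (p : {poly R}) i :
  (hermite_step s a p)`_i =
  (if i is i'.+1 then p`_i' else 0) - a * p`_i - s * (p`_i.+1 *+ i.+1).
Proof.
rewrite /hermite_step coefB mulrBl coefB coefXM coefCM coefZ coef_deriv.
by case: i.
Qed.

Section Main.
Variable R : realType.

(** The characteristic polynomial of the Jacobian. Nodes are repeated because
    stationarity of its integral in a weight and in the corresponding node makes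
    the node a double root. *)
Definition quintic (s u v1 v2 : R) := backward_heat s [:: u; v1; v1; v2; v2].

(** The integral of [quintic] of the base point [(u0, s0, t0, w0)] against the
    mixture of parameters [(m, u, s, t, w)], arranged so that every term has two
    factors among [a], [alpha], [beta] and [s - s0], which vanish at the base
    point. With [y = v - u0] and [g = y ^+ 2 - t0 * y - w0], the polynomial to
    integrate is [Q + (s - s0) / 2 * Q'' + (s - s0) ^+ 2 / 8 * Q''''] for
    [Q = y * g ^+ 2], against the discrete measure on the nodes, where [g]
    equals [alpha * (v - u) + beta]. *)
Definition quintic_remainder (m u s t w u0 s0 t0 w0 : R) : R :=
  let a := u - u0 in
  let alpha := t - t0 + 2 * a in
  let beta := w - w0 + a ^+ 2 - t0 * a in
  m * (alpha ^+ 2 * (w * (t + a)) + 2 * (alpha * beta) * w + a * beta ^+ 2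
    + (s - s0) / 2 * (4 * (2 * alpha * w + beta * (2 * a - t0))
        + 2 * (4 * (alpha * w + a * beta) + a * (4 * w0 + t0 ^+ 2))
        + 4 * (alpha * w + a * beta))
    + (s - s0) ^+ 2 / 8 * (120 * a - 48 * t0)).

Lemma quintic_coefs (s u v1 v2 : R) i :
  (quintic s u v1 v2)`_i =
  let e1 := v1 + v2 in let e2 := v1 * v2 in
  let q := [:: e2 ^+ 2 - s * (e1 ^+ 2 + 2 * e2) + 3 * s ^+ 2;
    6 * s * e1 - 2 * e1 * e2; e1 ^+ 2 + 2 * e2 - 6 * s; - 2 * e1; 1] in
  (if i is i'.+1 then q`_i' else 0) - u * q`_i - s * (q`_i.+1 *+ i.+1).
Proof.
rewrite coef_hermite_step /=.
have c1 j : (hermite_step s v2 1)`_j = [:: - v2; 1]`_j.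
  rewrite coef_hermite_step; case: j => [|[|j]]; rewrite !coef1 /= ?nth_nil; by ring.
have c2 j : (hermite_step s v2 (hermite_step s v2 1))`_j =
    [:: v2 ^+ 2 - s; - 2 * v2; 1]`_j.
  rewrite coef_hermite_step; case: j => [|[|[|j]]]; rewrite !c1 /= ?nth_nil; by ring.
have c3 j : (hermite_step s v1 (hermite_step s v2 (hermite_step s v2 1)))`_j =
    [:: (- v1) * (v2 ^+ 2 - s) + 2 * s * v2;
      v2 ^+ 2 - 3 * s + 2 * v1 * v2; - v1 - 2 * v2; 1]`_j.
  rewrite coef_hermite_step; case: j => [|[|[|[|j]]]]; rewrite !c2 /= ?nth_nil; by ring.
have c4 j : (hermite_step s v1 (hermite_step s v1
     (hermite_step s v2 (hermite_step s v2 1))))`_j =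
    [:: (v1 * v2) ^+ 2 - s * ((v1 + v2) ^+ 2 + 2 * (v1 * v2)) + 3 * s ^+ 2;
    6 * s * (v1 + v2) - 2 * (v1 + v2) * (v1 * v2);
    (v1 + v2) ^+ 2 + 2 * (v1 * v2) - 6 * s; - 2 * (v1 + v2); 1]`_j.
  rewrite coef_hermite_step; case: j => [|[|[|[|[|j]]]]]; rewrite !c3 /= ?nth_nil; by ring.
by case: i => [|i]; rewrite !c4.
Qed.

Lemma quintic_expectation (m u s t w u0 s0 v1 v2 : R) :
  \sum_(i < 6) (quintic s0 u0 v1 v2)`_i * mixture_moment m u s t w i =
  quintic_remainder m u s t w u0 s0 (v1 + v2 - 2 * u0)
    (- ((v1 - u0) * (v2 - u0))).
Proof.
rewrite !big_ord_recl big_ord0 !quintic_coefs /= /quintic_remainder /=.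
have [a ->] : exists a, u = a + u0 by exists (u - u0); ring.
have [x ->] : exists x, v1 = x + u0 by exists (v1 - u0); ring.
have [y ->] : exists y, v2 = y + u0 by exists (v2 - u0); ring.
rewrite !addrK.
have -> : x + u0 + (y + u0) - 2 * u0 = x + y by ring.
rewrite /bump /= !addSn !add0n; by field.
Qed.

Local Notation params := ('rV[R]_2 * 'rV[R]_2 * R)%type.
Implicit Types (p : params) (M : 'rV[R]_5).

Definition quintic_at p :=
  quintic (width p ^+ 2) (mean p) (node p 0) (node p 1).

Lemma norm_entry_le n (A : 'rV[R]_n) i : `|A 0 i| <= `|A|.
Proof.
rewrite [leRHS]/Num.Def.normr /= mx_normrE.
exact: (le_bigmax _ (fun ij : 'I_1 * 'I_n => `|A ij.1 ij.2|) (0, i)).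
Qed.

Lemma lipschitz_mom (M0 : 'rV[R]_5) k :
  lipschitz_to M0 (fun M => mom M k) (mom M0 k).
Proof.
apply: lipschitz_nonexpansive => M; rewrite /mom.
have -> : M 0 (inord k) - M0 0 (inord k) = (M - M0) 0 (inord k) by rewrite !mxE.
exact: norm_entry_le.
Qed.

Section Near.
Variable M0 : 'rV[R]_5.
Hypothesis m0 : 0 < mom M0 0.

Lemma lipschitz_energy : lipschitz_to M0 (@energy R) (energy M0).
Proof.
apply: lipschitzM; last first.
  apply: lipschitzV; first by rewrite exprn_gt0.
  by apply: lipschitzX; exact: lipschitz_mom.
apply: lipschitzB; last by apply: lipschitzX; exact: lipschitz_mom.
by apply: lipschitzM; exact: lipschitz_mom.
Qed.

Lemma lipschitz_heat_flux : lipschitz_to M0 (@heat_flux R) (heat_flux M0).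
Proof.
apply: lipschitzM; last first.
  apply: lipschitzV; first by rewrite exprn_gt0.
  by apply: lipschitzX; exact: lipschitz_mom.
apply: lipschitzB; last first.
  apply: lipschitzM.
    by apply: lipschitzM; [exact: lipschitz_cst|exact: lipschitz_mom].
  apply: lipschitzB; last by apply: lipschitzX; exact: lipschitz_mom.
  by apply: lipschitzM; exact: lipschitz_mom.
apply: lipschitzB; last by apply: lipschitzX; exact: lipschitz_mom.
apply: lipschitzM; first exact: lipschitz_mom.
by apply: lipschitzX; exact: lipschitz_mom.
Qed.

Lemma lipschitz_eta4 : lipschitz_to M0 (@eta4 R) (eta4 M0).
Proof.
have lX k j : lipschitz_to M0 (fun M => mom M k ^+ j) (mom M0 k ^+ j).
  by apply: lipschitzX; exact: lipschitz_mom.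
have l1 k := @lipschitz_mom M0 k.
have lc c := @lipschitz_cst R _ M0 c.
apply: lipschitzM; last by apply: lipschitzV; [rewrite exprn_gt0|exact: lX].
apply: lipschitzD; last by do 2?[apply: lipschitzM; last by []]; apply: lipschitzM.
apply: lipschitzB; last by do 2?[apply: lipschitzM; last by []]; apply: lipschitzM.
by apply: lipschitzD; apply: lipschitzM.
Qed.

(** The condition at [q = 0] is not open, but near a point with distinct nodes
    one of two open conditions implies it. *)
Lemma near_Omega : Omega M0 ->
  eta4 M0 < 3 * energy M0 ^+ 2 \/ heat_flux M0 != 0 ->
  \forall M \near M0, Omega M.
Proof.
case=> _ e0 n0 _ side.
have le := lipschitz_energy; have lq := lipschitz_heat_flux.
have ln := lipschitz_eta4.
have strict : \forall M \near M0,
    0 < eta4 M - (energy M ^+ 2 + heat_flux M ^+ 2 / energy M).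
  apply: (@lipschitz_gt0 _ _ _ _
    (eta4 M0 - (energy M0 ^+ 2 + heat_flux M0 ^+ 2 / energy M0)));
    last by rewrite subr_gt0.
  apply: lipschitzB => //; apply: lipschitzD; first exact: lipschitzX.
  by apply: lipschitzM; [exact: lipschitzX|exact: lipschitzV].
have cond : \forall M \near M0, heat_flux M = 0 -> eta4 M <= 3 * energy M ^+ 2.
  case: side => [side|q0].
    have : \forall M \near M0, 0 < 3 * energy M ^+ 2 - eta4 M.
      apply: (@lipschitz_gt0 _ _ _ _ (3 * energy M0 ^+ 2 - eta4 M0));
        last by rewrite subr_gt0.
      apply: lipschitzB => //.
      by apply: lipschitzM; [exact: lipschitz_cst|exact: lipschitzX].
    by apply: filterS => M; rewrite subr_gt0 => /ltW.
  have : \forall M \near M0, 0 < heat_flux M ^+ 2.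
    apply: (@lipschitz_gt0 _ _ _ _ (heat_flux M0 ^+ 2)); first exact: lipschitzX.
    by rewrite exprn_even_gt0.
  by apply: filterS => M h qM; rewrite qM expr0n ltxx in h.
near=> M; split.
- by near: M; exact: (lipschitz_gt0 (@lipschitz_mom M0 0)).
- by near: M; exact: (lipschitz_gt0 le).
- by rewrite -subr_gt0; near: M.
- by near: M.
Unshelve. all: by end_near. Qed.
End Near.

Lemma reconstruction_facts M : Omega M -> let p := reconstruction M in
  [/\ admissible p,
   forall k, (k < 5)%N -> mom M k =
     mixture_moment (mass p) (mean p) (width p ^+ 2) (skewness p) (spread p) k,
   Mbar5 M =
     mixture_moment (mass p) (mean p) (width p ^+ 2) (skewness p) (spread p) 5
  & [/\ energy M = spread p + width p ^+ 2, heat_flux M = skewness p * spread p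
    & eta4 M - 3 * energy M ^+ 2 =
      spread p * skewness p ^+ 2 - 2 * spread p ^+ 2]].
Proof.
move=> hM p; have hp : is_reconstruction M p := reconstructionP hM.
have ap : admissible p by case: hp.
have hk k : (k < 5)%N -> mom M k =
    mixture_moment (mass p) (mean p) (width p ^+ 2) (skewness p) (spread p) k.
  by move=> k5; rewrite -moments_mom // (reconstruction_momentsE hp).
have mn0 : mass p != 0 by rewrite gt_eqF // mass_gt0.
have [e q n] := mixture_energy mn0 hk.
split=> //; first by rewrite /Mbar5 fG_moment_mixture.
split=> //; rewrite n e -/p.
set w := spread p; set t := skewness p; set s := width p ^+ 2.
by ring.
Qed.

Lemma mul_companionT (q : {poly R}) (v : 'rV[R]_5) i :
  (v *m (companion 5 q)^T) 0 i =
  if (i < 4)%N then v 0 (inord i.+1) else - \sum_(j < 5) q`_j * v 0 j.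
Proof.
have compE j : (companion 5 q)^T j i =
    if i == 4 :> nat then - q`_j else (i.+1 == j :> nat)%:R.
  by rewrite [LHS]mxE [LHS]mxE.
rewrite mxE (eq_bigr _ (fun j _ => congr1 ( *%R (v 0 j)) (compE j))).
case: ifPn => i4.
  rewrite (ltn_eqF i4) (bigD1 (inord i.+1)) //= big1 ?addr0; last first.
    move=> j ji; case: eqP => [e|_]; last by rewrite mulr0.
    by move: ji; rewrite -val_eqE /= inordK ?e ?eqxx // -e.
  by rewrite inordK // eqxx mulr1.
have -> : (i == 4 :> nat) by rewrite eqn_leq -ltnS ltn_ord /= leqNgt.
by rewrite -sumrN; apply: eq_bigr => j _; rewrite mulrN mulrC.
Qed.

Lemma flux_difference (M N : 'rV[R]_5) i :
  (eqmom_flux M - eqmom_flux N) 0 i =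
  if (i < 4)%N then mom M i.+1 - mom N i.+1 else Mbar5 M - Mbar5 N.
Proof.
have fluxE (L : 'rV[R]_5) : eqmom_flux L 0 i =
    if (i < 4)%N then mom L i.+1 else Mbar5 L by rewrite mxE.
have rowB (v v' : 'rV[R]_5) : (v - v') 0 i = v 0 i - v' 0 i by rewrite !mxE.
apply: etrans (rowB _ _) _.
apply: etrans (congr2 (fun x y : R => x - y) (fluxE M) (fluxE N)) _.
by case: (i < 4)%N.
Qed.

Section FluxJacobian.
Variable p0 : params.
Hypothesis (ap0 : admissible p0) (dp0 : distinct_nodes p0).
Let M0 := moments_of p0.
Let w0 := spread p0.
Let t0 := skewness p0.
Let s0 := width p0 ^+ 2.
Let u0 := mean p0.

Let w0_gt0 : 0 < w0. Proof. exact: spread_gt0. Qed.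

Let momE k : (k < 5)%N -> mom M0 k = mixture_moment (mass p0) u0 s0 t0 w0 k.
Proof. by move=> k5; rewrite moments_mom. Qed.

Let mom0_gt0 : 0 < mom M0 0. Proof. by rewrite momE // mass_gt0. Qed.

Let base : [/\ energy M0 = w0 + s0, heat_flux M0 = t0 * w0
  & eta4 M0 = w0 * (t0 ^+ 2 + w0) + 6 * w0 * s0 + 3 * s0 ^+ 2].
Proof. by apply: mixture_energy momE; rewrite gt_eqF ?mass_gt0. Qed.

Let nearO : \forall M \near M0, Omega M.
Proof.
apply: near_Omega => //; first exact: Omega_moments.
have [e q n] := base; have [t00|tn0] := eqVneq t0 0.
  by left; rewrite n e t00; have := w0_gt0; nra.
by right; rewrite q mulf_neq0 // gt_eqF.
Qed.

Local Notation rec M := (reconstruction M).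

Lemma lipschitz_mass : lipschitz_to M0 (fun M => mass (rec M)) (mass p0).
Proof.
have := @lipschitz_mom M0 0; rewrite momE //; apply: lipschitz_near.
by apply: filterS nearO => M /reconstruction_facts[_ /(_ 0%N erefl) -> _ _].
Qed.

Lemma lipschitz_mean : lipschitz_to M0 (fun M => mean (rec M)) u0.
Proof.
have -> : u0 = mom M0 1 / mom M0 0.
  by rewrite !momE //= mulrC mulKf // gt_eqF ?mass_gt0.
apply: (@lipschitz_near _ _ _ (fun M => mom M 1 / mom M 0)); last first.
  by apply: lipschitzM; [|apply: lipschitzV => //]; exact: lipschitz_mom.
apply: filterS nearO => M /reconstruction_facts[ap h _ _].
by rewrite !h //= mulrC mulKf // gt_eqF ?mass_gt0.
Qed.

(** Write [F (w) = 2 w^3 + (eta - 3 e^2) w - q^2] at [M], and [F0] at [M0]. From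
    [F (w) = F0 (w0) = 0] one gets [D * (w - w0) = num], where [num] is
    Lipschitz and [D = 2 w w0 + 2 w0^2 + w t^2] is at least [2 w0^2]. The
    bound holds for whichever mixture has the given moments, so it also shows
    that the moments determine the spread. *)
Lemma lipschitz_spread : lipschitz_to M0 (fun M => spread (rec M)) w0.
Proof.
have [e0 q0 n0] := base.
pose num M := (heat_flux M ^+ 2 - heat_flux M0 ^+ 2)
  - w0 * ((eta4 M - 3 * energy M ^+ 2) - (eta4 M0 - 3 * energy M0 ^+ 2)).
have [C hC] : bigO_pow M0 1 num.
  have le := lipschitz_energy mom0_gt0; have lq := lipschitz_heat_flux mom0_gt0.
  have ln := lipschitz_eta4 mom0_gt0.
  have -> : num = (fun M => (heat_flux M ^+ 2 - heat_flux M0 ^+ 2)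
     + - w0 * ((eta4 M - 3 * energy M ^+ 2) - (eta4 M0 - 3 * energy M0 ^+ 2))).
    by apply/funext => M; rewrite /num; ring.
  apply: bigO_powD; first exact: lipschitzX.
  apply: bigO_powZ; apply: lipschitzB => //.
  by apply: lipschitzM; [exact: lipschitz_cst|exact: lipschitzX].
exists (C / (2 * w0 ^+ 2)); near=> M.
have OM : Omega M by near: M.
have [ap _ _ [e q n]] := reconstruction_facts OM.
have w_ge0 := spread_ge0 ap; have w0p := w0_gt0.
set w := spread _ in e q n w_ge0 *; set t := skewness _ in q n.
pose D := 2 * w * w0 + 2 * w0 ^+ 2 + w * t ^+ 2.
have Dge : 2 * w0 ^+ 2 <= D.
  have := mulr_ge0 w_ge0 (sqr_ge0 t); have := mulr_ge0 w_ge0 (ltW w0p).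
  rewrite /D; lra.
have numE : num M = D * (w - w0).
  rewrite /num n q n0 q0 e0 /D; ring.
have w2 : 0 < 2 * w0 ^+ 2 by rewrite mulr_gt0 // exprn_gt0.
rewrite mulrAC ler_pdivlMr //.
apply: le_trans (_ : `|num M| <= _); last by near: M.
rewrite numE normrM mulrC ler_wpM2r //.
by apply: le_trans Dge _; rewrite ler_norm.
Unshelve. all: by end_near. Qed.

Lemma lipschitz_skewness : lipschitz_to M0 (fun M => skewness (rec M)) t0.
Proof.
have [e0 q0 n0] := base.
have -> : t0 = heat_flux M0 * w0^-1 by rewrite q0 mulfK // gt_eqF.
apply: (@lipschitz_near _ _ _ (fun M => heat_flux M * (spread (rec M))^-1)); last first.
  apply: lipschitzM; first exact: lipschitz_heat_flux.
  by apply: lipschitzV => //; exact: lipschitz_spread.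
have hw := lipschitz_gt0 lipschitz_spread w0_gt0.
near=> M; have OM : Omega M by near: M.
have [_ _ _ [_ -> _]] := reconstruction_facts OM.
by rewrite mulfK // gt_eqF //; near: M.
Unshelve. all: by end_near. Qed.

Lemma lipschitz_width2 : lipschitz_to M0 (fun M => width (rec M) ^+ 2) s0.
Proof.
have [e0 q0 n0] := base.
have -> : s0 = energy M0 - w0 by rewrite e0 addrC addKr.
apply: (@lipschitz_near _ _ _ (fun M => energy M - spread (rec M))).
  apply: filterS nearO => M /reconstruction_facts[_ _ _ [-> _ _]].
  by rewrite addrC addKr.
apply: lipschitzB; [exact: lipschitz_energy|exact: lipschitz_spread].
Qed.

Let rem M := let p := rec M in
  quintic_remainder (mass p) (mean p) (width p ^+ 2) (skewness p) (spread p)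
    u0 s0 t0 w0.

Lemma bigO_rem : bigO_pow M0 2 rem.
Proof.
have lm := lipschitz_bounded lipschitz_mass.
have la : bigO_pow M0 1 (fun M => mean (rec M) - u0) := lipschitz_mean.
have ls : bigO_pow M0 1 (fun M => width (rec M) ^+ 2 - s0) := lipschitz_width2.
have lt : bigO_pow M0 1 (fun M => skewness (rec M) - t0) := lipschitz_skewness.
have lw : bigO_pow M0 1 (fun M => spread (rec M) - w0) := lipschitz_spread.
have ba := bigO_pow_le (leq0n 1) la.
have bw := lipschitz_bounded lipschitz_spread.
have bt := lipschitz_bounded lipschitz_skewness.
pose a M := mean (rec M) - u0; pose ds M := width (rec M) ^+ 2 - s0.
pose al M := skewness (rec M) - t0 + 2 * a M.
pose be M := spread (rec M) - w0 + (a M * a M + - t0 * a M).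
have lal : bigO_pow M0 1 al by apply: bigO_powD => //; exact: bigO_powZ.
have lbe : bigO_pow M0 1 be.
  apply: bigO_powD => //; apply: bigO_powD; last exact: bigO_powZ.
  by apply: (bigO_powM la ba).
have bc c : bigO_pow M0 0 (fun=> c) := bigO_pow_cst M0 c.
have D0 := @bigO_powD R _ M0 0; have Z0 := @bigO_powZ R _ M0 0.
have M00 := @bigO_powM R _ M0 0 0.
have M11 f g h : bigO_pow M0 1 f -> bigO_pow M0 1 g -> bigO_pow M0 0 h ->
    bigO_pow M0 2 (fun M => f M * g M * h M).
  by move=> hf hg hh; apply: (bigO_powM (bigO_powM hf hg) hh).
pose m M := mass (rec M).
apply: (@eq_bigO_pow _ _ _ _ (fun M =>
    al M * al M * (m M * (spread (rec M) * (skewness (rec M) + a M)))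
  + (al M * be M * (2 * (m M * spread (rec M)))
  + (be M * be M * (m M * a M)
  + (ds M * al M * (10 * (m M * spread (rec M)))
  + (ds M * be M * (m M * (10 * a M + - 2 * t0))
  + (ds M * a M * (m M * (4 * w0 + t0 ^+ 2))
  + ds M * ds M * (m M * (15 * a M + - 6 * t0))))))))).
  by move=> M; rewrite /rem /quintic_remainder /al /be /a /ds /m; field.
repeat apply: bigO_powD; apply: (M11) => //.
- by apply: (M00) => //; apply: (M00) => //; exact: (D0).
- by apply: (Z0); exact: M00.
- exact: M00.
- by apply: (Z0); exact: M00.
- by apply: (M00) => //; apply: (D0) => //; exact: Z0.
- exact: M00.
- by apply: (M00) => //; apply: (D0) => //; exact: Z0.
Qed.

(** [rem] is the error made by approximating [Mbar5] by the linear form whose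
    coefficients are those of [- quintic_at p0]. *)
Lemma quintic_functional M : Omega M ->
  \sum_(i < 5) (quintic_at p0)`_i * M 0 i + Mbar5 M = rem M.
Proof.
move=> OM; have [ap h h5 _] := reconstruction_facts OM.
rewrite /rem -quintic_expectation [RHS]big_ord_recr /= h5; congr (_ + _).
  by apply: eq_bigr => i _; rewrite -h // /mom inord_val.
by rewrite quintic_coefs /=; ring.
Qed.

Lemma norm_row_le n (A : 'rV[R]_n) c : 0 <= c -> (forall i, `|A 0 i| <= c) ->
  `|A| <= c.
Proof.
move=> c0 h; rewrite [leLHS]/Num.Def.normr /= mx_normrE.
by apply: bigmax_le => // -[i j] _ /=; rewrite ord1.
Qed.

(** The statement is for the moments of arbitrary parameters, rather than for a
    chosen reconstruction, since the limit at coincident nodes runs over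
    parameters. *)
Lemma flux_jacobian : differentiable (@eqmom_flux R) M0 /\
  jac_mx (@eqmom_flux R) M0 = companion 5 (quintic_at p0).
Proof.
have OM0 : Omega M0 by exact: Omega_moments.
have [C hC] := bigO_rem.
have rem0 : rem M0 = 0.
  have := nbhs_singleton hC; rewrite /= subrr normr0 expr0n mulr0.
  by rewrite normr_le0 => /eqP.
have [] := @jacobian_quadratic_remainder _ _ (@eqmom_flux R) M0
  (companion 5 (quintic_at p0))^T `|C|; last first.
  by move=> dF eF; split=> //; rewrite /jac_mx eF trmxK.
near=> M; have OM : Omega M by near: M.
apply: norm_row_le => [|i]; first by rewrite mulr_ge0 ?exprn_ge0.
have rowB (v v' : 'rV[R]_5) j : (v - v') 0 j = v 0 j - v' 0 j by rewrite !mxE.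
rewrite rowB flux_difference mul_companionT.
case: ifP => i4; first by rewrite rowB /mom subrr normr0 mulr_ge0 ?exprn_ge0.
have -> : Mbar5 M - Mbar5 M0
    - - (\sum_(j < 5) (quintic_at p0)`_j * (M - M0) 0 j) = rem M - rem M0.
  rewrite -!quintic_functional // opprK opprD addrACA addrC -sumrB; congr (_ + _).
  by apply: eq_bigr => j _; rewrite rowB mulrBr.
rewrite rem0 subr0; apply: le_trans (_ : C * `|M - M0| ^+ 2 <= _); first by near: M.
by rewrite ler_wpM2r ?exprn_ge0 // ler_norm.
Unshelve. all: by end_near. Qed.

End FluxJacobian.
End Main.

(** * Coalescing nodes *)

Section Limit.
Variable R : realType.
Local Notation params := ('rV[R]_2 * 'rV[R]_2 * R)%type.
Implicit Types (p : params) (M : 'rV[R]_5).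

(** Real roots, repeated or not, become simple under [exp (- s D^2 / 2)]. *)
Lemma diagonalizable_quintic (s u v1 v2 : R) : 0 < s ->
  diagonalizable (companion 5 (quintic s u v1 v2)).
Proof.
move=> s0.
have [rs [sz srt e]] := real_rooted_backward_heat [:: u; v1; v1; v2; v2] s0.
apply: diagonalizable_companion e; first by rewrite sz.
apply: sorted_uniq srt => [y z t zy yt|z]; first exact: lt_trans yt zy.
by rewrite /= ltxx.
Qed.

Lemma mx_cvg_entries (T : Type) (F : set_system T) m n (A : T -> 'M[R]_(m, n))
    (B : 'M[R]_(m, n)) : Filter F ->
  (forall i j, A t i j @[t --> F] --> B i j) -> A t @[t --> F] --> B.
Proof.
move=> FF h; rewrite [B]matrix_sum_delta.
have -> : A = fun t => \sum_i \sum_j A t i j *: delta_mx i j.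
  by apply/funext => t; rewrite -matrix_sum_delta.
apply: cvg_big => [|i _]; first exact: add_continuous.
apply: cvg_big => [|j _]; first exact: add_continuous.
by apply: cvgZ; [exact: h|exact: cvg_cst].
Qed.

Lemma cvg_coef_hermite_step (T : Type) (F : set_system T) (s a : T -> R)
    (q : T -> {poly R}) (s0 a0 : R) (q0 : {poly R}) : Filter F ->
  s t @[t --> F] --> s0 -> a t @[t --> F] --> a0 ->
  (forall i, (q t)`_i @[t --> F] --> q0`_i) ->
  forall i, (hermite_step (s t) (a t) (q t))`_i @[t --> F]
    --> (hermite_step s0 a0 q0)`_i.
Proof.
move=> FF hs ha hq i; rewrite coef_hermite_step.
under eq_cvg do rewrite coef_hermite_step.
apply: cvgB; last first.
  apply: cvgM => //; rewrite -mulr_natr.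
  under eq_cvg do rewrite -mulr_natr.
  by apply: cvgM => //; exact: cvg_cst.
apply: cvgB; last exact: cvgM.
by case: i => [|i] //; exact: cvg_cst.
Qed.

Lemma cvg_companion (T : Type) (F : set_system T) n (q : T -> {poly R})
    (q0 : {poly R}) : Filter F ->
  (forall i, (q t)`_i @[t --> F] --> q0`_i) ->
  companion n (q t) @[t --> F] --> companion n q0.
Proof.
move=> FF hq; apply: mx_cvg_entries => i j.
rewrite mxE; under eq_cvg do rewrite mxE.
by case: ifP => _; [exact: cvgN|exact: cvg_cst].
Qed.

Lemma cvg_companion_quintic (T : Type) (F : set_system T)
    (s u v1 v2 : T -> R) (s0 u0 v10 v20 : R) : Filter F ->
  s t @[t --> F] --> s0 -> u t @[t --> F] --> u0 ->
  v1 t @[t --> F] --> v10 -> v2 t @[t --> F] --> v20 ->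
  companion 5 (quintic (s t) (u t) (v1 t) (v2 t)) @[t --> F]
    --> companion 5 (quintic s0 u0 v10 v20).
Proof.
move=> FF hs hu h1 h2; apply: cvg_companion => i.
rewrite /quintic /backward_heat /=.
do 5?[apply: cvg_coef_hermite_step => // {}i].
exact: cvg_cst.
Qed.

Lemma weight_continuous a : continuous (fun p => weight p a).
Proof.
move=> p.
apply: (cvg_comp (fun q : params => q.1.1) (fun v : 'rV[R]_2 => v 0 a));
  last exact: coord_continuous.
apply: (cvg_comp (fun q : params => q.1) (fun q => q.1)).
  exact: cvg_fst.
exact: cvg_fst.
Qed.

Lemma node_continuous a : continuous (fun p => node p a).
Proof.
move=> p.
apply: (cvg_comp (fun q : params => q.1.2) (fun v : 'rV[R]_2 => v 0 a));
  last exact: coord_continuous.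
apply: (cvg_comp (fun q : params => q.1) (fun q => q.2)).
  exact: cvg_fst.
exact: cvg_snd.
Qed.

Lemma width_continuous : continuous (fun p => width p).
Proof. by move=> p; exact: cvg_snd. Qed.

Lemma mean_cvg p : admissible p -> mean q @[q --> p] --> mean p.
Proof.
move=> ap; have m0 := mass_gt0 ap.
have cM : mass q @[q --> p] --> mass p.
  by apply: cvgD; exact: weight_continuous.
apply: cvgM; last by apply: cvgV => //; rewrite gt_eqF.
by apply: cvgD; apply: cvgM; by [exact: weight_continuous|exact: node_continuous].
Qed.

(** Moving one node slightly separates coincident nodes. Properness makes the
    limit of the Jacobians unique. *)
Lemma distinct_params_proper p : admissible p -> ~ distinct_nodes p ->
  ProperFilter (within [set p' | admissible p' /\ distinct_nodes p'] (nbhs p)).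
Proof.
move=> ap dp; apply: within_nbhs_proper => B nB.
pose c (e : R) : params := ((p.1.1, p.1.2 + e *: delta_mx 0 0), p.2).
have cc : c e @[e --> 0^'+] --> p.
  apply: cvg_at_right_filter; rewrite /c.
  have cn : p.1.2 + e *: (delta_mx 0 0 : 'rV[R]_2) @[e --> (0 : R)] --> p.1.2.
    have e0 : p.1.2 = p.1.2 + (0 : R) *: (delta_mx 0 0 : 'rV[R]_2).
      by rewrite scale0r addr0.
    rewrite [X in _ --> X]e0.
    by apply: cvgD; [exact: cvg_cst|apply: cvgZ; [exact: cvg_id|exact: cvg_cst]].
  case: p @c ap dp nB cn => [[a b] s] c /= _ _ _ cn.
  apply: (@cvg_pair _ _ _ _ (nbhs (a, b)) (nbhs s)); last exact: cvg_cst.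
  by apply: (@cvg_pair _ _ _ _ (nbhs a) (nbhs b)); [exact: cvg_cst|exact: cn].
have nc : \forall e \near 0^'+, B (c e) by exact: cc.
have [e [e0 Be]] : exists e : R, 0 < e /\ B (c e).
  apply: (@filter_ex _ (0^'+)); near=> e; split; last by near: e.
  by near: e; exact: nbhs_right_gt.
exists (c e); split=> //; split=> //.
rewrite /distinct_nodes /node /c /= !mxE /= mulr0 addr0 mulr1.
have -> : p.1.2 0 0 = p.1.2 0 1 by apply/eqP/negPn/negP.
by rewrite -subr_eq0 addrAC subrr add0r gt_eqF.
Unshelve. all: by end_near. Qed.

Lemma flux_jacobian_limit p : admissible p ->
  jac_mx (@eqmom_flux R) (moments_of p') @[p' --> within
    [set p' | admissible p' /\ distinct_nodes p'] (nbhs p)]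
  --> companion 5 (quintic_at p).
Proof.
move=> ap; apply: cvg_trans (_ : companion 5 (quintic_at p') @[p' --> within
    [set p' | admissible p' /\ distinct_nodes p'] (nbhs p)] `=>` _).
  apply: near_eq_cvg; apply: filterS (@near_withinT _ _ _ _) => p' /= [ap' dp'].
  by have [_ ->] := flux_jacobian ap' dp'.
apply: cvg_within_filter; apply: cvg_companion_quintic.
- apply: cvgM; exact: width_continuous.
- exact: mean_cvg.
- exact: node_continuous.
- exact: node_continuous.
Qed.
End Limit.

Theorem theorem3p2 (R : realType) (A : R -> R) (M : 'rV[R]_5)
  (hM : Omega M) : hyperbolic_at (eqmom_system A) M.
Proof.
set p := reconstruction M.
have hp : is_reconstruction M p := reconstructionP hM.
have ap : admissible p by case: hp.
have s0 : 0 < width p ^+ 2 by case: ap => _ s0; rewrite exprn_gt0.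
have diag : diagonalizable (companion 5 (quintic_at p)).
  exact: diagonalizable_quintic.
have [dp|ndp] := pselect (distinct_nodes p).
  have := flux_jacobian ap dp; rewrite (reconstruction_momentsE hp) => -[dF eF].
  split; first by exists (companion 5 (quintic_at p)); split.
  by move=> J [/(_ dp)[_ ->] _]; rewrite /= eF.
have lim := flux_jacobian_limit ap.
split; first by exists (companion 5 (quintic_at p)); split.
move=> J [_ /(_ ndp) limJ].
have pf := distinct_params_proper ap ndp.
by rewrite (cvg_unique _ limJ lim).
Qed.
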